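(* Let $q=5^k$ with $k$ a positive odd integer, and for $A,B,C,D\in\mathbb{F}_5$ let $$g_{A,B,C,D}(x)=x\,\frac{(x^2+Ax+B)^2}{(x^2+Cx+D)^2}.$$ Then $g_{A,B,C,D}$ permutes $\mathbb{F}_q$ whenever $[A,B,C,D]$ is one of the following tuples (entries taken modulo $5$): $$[4,2,1,2],\ [4,2,3,3],\ [2,3,4,2],\ [2,3,3,3],\ [1,2,4,2],\ [1,2,2,3],\ [3,3,1,2],\ [3,3,2,3],\ [0,3,0,2],\ [0,2,0,3].$$
   Context: $\mathbb{F}_q$ is the finite field with $q$ elements. A rational function ''permutes'' a set $S$ if it induces a well-defined bijection of $S$ onto itself. *)

(* Defs.v *)
From HB Require Import structures.
From mathcomp Require Import all_boot all_order all_algebra all_field.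

Set Implicit Arguments.
Unset Strict Implicit.
Unset Printing Implicit Defensive.

Import GRing.Theory.
Local Open Scope ring_scope.

Section RationalFunctions.
Variable K : fieldType.

(* [K(x)] has no evaluation map in the library. A rational function is defined
   at [x], with a value in [K], when some representative fraction has a
   denominator not vanishing at [x]; the value does not depend on which such
   representative is chosen. *)
Definition has_value (f : {fraction {poly K}}) (x y : K) : Prop :=
  exists P Q : {poly K},
    [/\ f = FracField.tofrac P / FracField.tofrac Q,
        Q.[x] != 0 & y = P.[x] / Q.[x]].

Definition permutes (f : {fraction {poly K}}) (S : {pred K}) : Prop :=
  exists h : K -> K,
    [/\ {in S, forall x, has_value f x (h x)},
        {in S, forall x, h x \in S},
        {in S &, injective h}
      & {in S, forall y, exists2 x, x \in S & h x = y}].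

(* The canonical embedding of the prime field, via representatives in 0..4;
   it is a ring morphism exactly when [K] has characteristic 5. *)
Definition of_F5 (a : 'F_5) : K := (a : nat)%:R.

Definition quadratic (a b : 'F_5) : {poly K} :=
  'X^2 + (of_F5 a)%:P * 'X + (of_F5 b)%:P.

Definition g (A B C D : 'F_5) : {fraction {poly K}} :=
  FracField.tofrac 'X
  * (FracField.tofrac (quadratic A B) ^+ 2
     / FracField.tofrac (quadratic C D) ^+ 2).

End RationalFunctions.

Arguments g K A B C D : clear implicits.

Definition tuples : seq ('F_5 * 'F_5 * 'F_5 * 'F_5) :=
  [:: (4, 2, 1, 2); (4, 2, 3, 3); (2, 3, 4, 2); (2, 3, 3, 3); (1, 2, 4, 2);
      (1, 2, 2, 3); (3, 3, 1, 2); (3, 3, 2, 3); (0, 3, 0, 2); (0, 2, 0, 3)].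

(* Main.v *)
(* For each tuple the numerator of g(x) - g(y) equals, modulo 5,
   (x - y) (P^2 - 2 Q^2), where P and Q are polynomials over F_5 in x + y and
   x y. As k is odd, 2 is not a square in F_q, so a zero off the diagonal is a
   common zero of P and Q, and there some element of F_q is a square root of 2
   or 3; this is impossible. Hence g is injective, thus bijective. The map
   g(x) -> u g(x/u) with u in F_5^* reduces the ten tuples to three. *)
Require Import Defs.
From mathcomp Require Import all_boot all_order all_algebra all_field.
From mathcomp Require Import ring.

Import GRing.Theory.

Section OddDegreeExtension.
Local Open Scope ring_scope.
Variables (k : nat) (F : finFieldType).
Hypotheses (k_odd : odd k) (cardF : #|F| = (5 ^ k)%N).

Lemma pchar5 : 5%N \in [pchar F].
Proof. exact: card_finPcharP cardF isT. Qed.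

Lemma five_eq0 : 5 = 0 :> F.
Proof. exact: pcharf0 pchar5. Qed.

Lemma natr_mod5 (m n : nat) : m = n %[mod 5] -> m%:R = n%:R :> F.
Proof.
move=> eq_mn; rewrite (divn_eq m 5) (divn_eq n 5) eq_mn !natrD !natrM.
by rewrite five_eq0 !mulr0.
Qed.

(* If [z ^+ 4 = -1] then [z ^+ 5 = - z], so that [z = z ^+ (5 ^ k) = - z]. *)
Lemma expr4D1_neq0 (z : F) : z ^+ 4 + 1 <> 0.
Proof.
move=> /eqP; rewrite addr_eq0 => /eqP z4.
have z5 n : z ^+ (5 ^ n) = (-1) ^+ odd n * z.
  elim: n => [|n IHn]; first by rewrite mul1r.
  rewrite expnSr exprM IHn exprMn [z ^+ 5]exprSr z4 oddS.
  by case: (odd n); ring.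
have zN : z = - z by rewrite -{1}(expf_card z) cardF z5 k_odd expr1 mulN1r.
have z0 : z = 0.
  have -> : z = 5 * z - 2 * (z - - z) by ring.
  by rewrite five_eq0 -zN; ring.
by move/eqP: z4; rewrite z0 expr0n eq_sym oppr_eq0 oner_eq0.
Qed.

(** Otherwise [u / v] is a square root of 2, and its fourth power 4 is -1 in characteristic 5. *)
Lemma sqr_eq2sqr (u v : F) : u ^+ 2 - 2 * v ^+ 2 = 0 -> u = 0 /\ v = 0.
Proof.
move=> uv; have [v0|v_neq0] := eqVneq v 0.
  by move/eqP: uv; rewrite v0 expr0n mulr0 subr0 sqrf_eq0 => /eqP.
case: (@expr4D1_neq0 (u / v)).
have -> : (u / v) ^+ 4 + 1
        = (u ^+ 2 - 2 * v ^+ 2) * (u ^+ 2 + 2 * v ^+ 2) / v ^+ 4 + 5.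
  by field.
by rewrite uv five_eq0 !mul0r addr0.
Qed.

Definition quad (a b : nat) (x : F) : F := x ^+ 2 + a%:R * x + b%:R.

Definition ratio (a b c d : nat) (x : F) : F :=
  x * quad a b x ^+ 2 / quad c d x ^+ 2.

(* The discriminant is congruent to [c ^ 2 + d] modulo 5, and the nonsquares
   2 and 3 of F_5 are the square roots of -1. *)
Lemma quad_neq0 (c d : nat) (x : F) : (5 %| (c ^ 2 + d) ^ 2 + 1)%N -> quad c d x != 0.
Proof.
move=> dv; apply/eqP => q0; case: (@expr4D1_neq0 (2 * x + c%:R)).
have n0 : (c%:R ^+ 2 + d%:R) ^+ 2 + 1 = 0 :> F.
  apply/eqP; rewrite -natrX -natrD -natrX natr1 -addn1.
  by rewrite -(dvdn_pcharf pchar5).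
(* Completing the square: [(2 * x + c) ^ 2] is [4 * quad c d x] plus the discriminant
   [c ^ 2 - 4 * d]. *)
have -> : (2 * x + c%:R) ^+ 4 + 1
  = quad c d x * (16 * x ^+ 2 + 16 * c%:R * x + 8 * c%:R ^+ 2 - 16 * d%:R)
    + ((c%:R ^+ 2 + d%:R) ^+ 2 + 1)
    + 5 * (3 * d%:R ^+ 2 - 2 * d%:R * c%:R ^+ 2).
  by rewrite /quad; ring.
by rewrite q0 n0 five_eq0; ring.
Qed.

(* The norm forms come from factoring, over F_25, the symmetric polynomial
   [(numerator of g x - g y) / (x - y)] in [s = x + y] and [p = x y]. *)
Definition norm_form_P1 (s p : F) :=
  4 - 2 * s - 4 * s ^+ 2 - 2 * p + s * p + p ^+ 2.
Definition norm_form_Q1 (s p : F) := s + s ^+ 2 + 2 * p - 3 * s * p.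
Definition norm_form_P2 (s p : F) :=
  - 1 - 2 * s - 4 * s ^+ 2 - 4 * p - 3 * s * p - p ^+ 2.
Definition norm_form_Q2 (s p : F) := - 4 * s + s ^+ 2 + 4 * s * p.
Definition norm_form_P3 (s p : F) := 4 + 2 * s ^+ 2 - p ^+ 2.
Definition norm_form_Q3 (s p : F) := s - s * p.

Lemma discr_sqrD1_neq0 (x y : F) : ((x + y) ^+ 2 - 4 * (x * y)) ^+ 2 + 1 <> 0.
Proof.
have -> : ((x + y) ^+ 2 - 4 * (x * y)) ^+ 2 = (x - y) ^+ 4 by ring.
exact: expr4D1_neq0.
Qed.

(* Modulo 5, [Q] splits into two linear factors, and on each of them [P] is
   quadratic in one variable and its roots make the discriminant
   [s ^ 2 - 4 p = (x - y) ^ 2] a square root of -1. *)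
Lemma no_zero1 (x y : F) :
  norm_form_P1 (x + y) (x * y) = 0 -> norm_form_Q1 (x + y) (x * y) = 0 -> False.
Proof.
have := @discr_sqrD1_neq0 x y; move: (x + y) (x * y) => s p nd P0 Q0; apply: nd.
have /eqP : (s + 1) * (s + 2 * p) = 0.
  transitivity (norm_form_Q1 s p + 5 * (s * p)).
    by rewrite /norm_form_Q1; ring.
  by rewrite Q0 five_eq0; ring.
rewrite mulf_eq0 !addr_eq0 => /orP[/eqP sE|/eqP sE].
  transitivity (16 * norm_form_P1 s p + 5 * (8 * p - 6)).
    by rewrite /norm_form_P1 sE; ring.
  by rewrite P0 five_eq0; ring.
(* The inner sum is [p ^ 2 - p + 3], and the discriminant is [4 * (p ^ 2 - p)]. *)
transitivity (16 * (2 * norm_form_P1 s p + 5 * (7 * p ^+ 2 - p - 1))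
  * (p ^+ 2 - p - 3) + 5 * 29).
  by rewrite /norm_form_P1 sE; ring.
by rewrite P0 five_eq0; ring.
Qed.

Lemma no_zero2 (x y : F) :
  norm_form_P2 (x + y) (x * y) = 0 -> norm_form_Q2 (x + y) (x * y) = 0 -> False.
Proof.
have := @discr_sqrD1_neq0 x y; move: (x + y) (x * y) => s p nd P0 Q0.
have /eqP : s * (s + 1 - p) = 0.
  transitivity (norm_form_Q2 s p + 5 * (s - s * p)).
    by rewrite /norm_form_Q2; ring.
  by rewrite Q0 five_eq0; ring.
rewrite mulf_eq0 => /orP[/eqP sE|].
  (* Here [P] has no root in F_5: it says that [2 p - 1] is a square root of 2. *)
  apply: (@expr4D1_neq0 (2 * p - 1)).
  transitivity ((- 4 * norm_form_P2 s p - 5 * (4 * p + 1))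
    * ((2 * p - 1) ^+ 2 + 2) + 5).
    by rewrite /norm_form_P2 sE; ring.
  by rewrite P0 five_eq0; ring.
rewrite subr_eq0 => /eqP pE; apply: nd.
(* The first factor is [s ^ 2 + 2 * s + 2]; dividing the goal's left side by it over the integers
   leaves the remainder -35. *)
transitivity ((3 * norm_form_P2 s p + 5 * (4 + 7 * s + 5 * s ^+ 2))
  * (s ^+ 2 - 10 * s + 26) - 5 * 7).
  by rewrite /norm_form_P2 -pE; ring.
by rewrite P0 five_eq0; ring.
Qed.

Lemma no_zero3 (x y : F) :
  norm_form_P3 (x + y) (x * y) = 0 -> norm_form_Q3 (x + y) (x * y) = 0 -> False.
Proof.
have := @discr_sqrD1_neq0 x y; move: (x + y) (x * y) => s p nd P0 Q0; apply: nd.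
have /eqP : s * (1 - p) = 0.
  by rewrite -Q0 /norm_form_Q3; ring.
rewrite mulf_eq0 subr_eq0 => /orP[/eqP sE|/eqP pE].
  transitivity (- 16 * norm_form_P3 s p + 5 * 13).
    by rewrite /norm_form_P3 sE; ring.
  by rewrite P0 five_eq0; ring.
transitivity ((3 * norm_form_P3 s p - 5 * (s ^+ 2 + 2)) * (s ^+ 2 - 7) + 5 * 2).
  by rewrite /norm_form_P3 -pE; ring.
by rewrite P0 five_eq0; ring.
Qed.

(** The term [5 * e] turns a factorization modulo 5 into an identity over the integers, which [ring]
    can check. *)
Lemma ratio_inj (a b c d : nat) (P Q : F -> F -> F) (e : F -> F -> F) :
  (5 %| (c ^ 2 + d) ^ 2 + 1)%N ->
  (forall x y, x * quad a b x ^+ 2 * quad c d y ^+ 2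
             - y * quad a b y ^+ 2 * quad c d x ^+ 2
    = (x - y) * (P (x + y) (x * y) ^+ 2 - 2 * Q (x + y) (x * y) ^+ 2
                 + 5 * e (x + y) (x * y))) ->
  (forall x y, P (x + y) (x * y) = 0 -> Q (x + y) (x * y) = 0 -> False) ->
  injective (ratio a b c d).
Proof.
move=> dv GE noPQ x y /eqP.
rewrite /ratio eqr_div ?expf_neq0 ?quad_neq0 // -subr_eq0 GE.
rewrite five_eq0 mul0r addr0 mulf_eq0 subr_eq0 => /orP[/eqP // | /eqP PQ0].
by have [/noPQ PQ /PQ] := sqr_eq2sqr _ _ PQ0.
Qed.

Lemma ratio_inj1 : injective (ratio 4 2 1 2).
Proof.
apply: (@ratio_inj _ _ _ _ norm_form_P1 norm_form_Q1
  (fun s p => - 4 * p + 8 * p ^+ 2 - p ^+ 3 + 16 * s + 22 * s ^+ 2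
     + 6 * s ^+ 2 * p ^+ 2 + 4 * s ^+ 3 - 2 * s ^+ 4)) => // [x y|].
  by rewrite /quad /norm_form_P1 /norm_form_Q1; ring.
exact: no_zero1.
Qed.

Lemma ratio_inj2 : injective (ratio 4 2 3 3).
Proof.
apply: (@ratio_inj _ _ _ _ norm_form_P2 norm_form_Q2
  (fun s p => 7 + 8 * p + 11 * p ^+ 2 + p ^+ 3 + 28 * s + 34 * s * p
     + 8 * s * p ^+ 2 + 40 * s ^+ 2 + s ^+ 2 * p + 6 * s ^+ 2 * p ^+ 2
     + 8 * s ^+ 3 + 2 * s ^+ 3 * p - s ^+ 4)) => // [x y|].
  by rewrite /quad /norm_form_P2 /norm_form_Q2; ring.
exact: no_zero2.
Qed.

Lemma ratio_inj3 : injective (ratio 0 3 0 2).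
Proof.
apply: (@ratio_inj _ _ _ _ norm_form_P3 norm_form_Q3
  (fun s p => 4 - 12 * p + 9 * p ^+ 2 - 2 * p ^+ 3 + 2 * s ^+ 2
     - 5 * s ^+ 2 * p + 2 * s ^+ 2 * p ^+ 2)) => // [x y|].
  by rewrite /quad /norm_form_P3 /norm_form_Q3; ring.
exact: no_zero3.
Qed.

Lemma ratio_scale (a b c d u a' b' c' d' : nat) :
  injective (ratio a b c d) ->
  ~~ (5 %| u)%N ->
  a' = u * a %[mod 5]%N -> b' = u ^ 2 * b %[mod 5]%N ->
  c' = u * c %[mod 5]%N -> d' = u ^ 2 * d %[mod 5]%N ->
  injective (ratio a' b' c' d').
Proof.
move=> ratioI; rewrite (dvdn_pcharf pchar5) => u0 /natr_mod5 aE /natr_mod5 bE /natr_mod5 cE.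
move=> /natr_mod5 dE.
have quadE m n m' n' (x : F) : m'%:R = (u * m)%N%:R :> F ->
    n'%:R = (u ^ 2 * n)%N%:R :> F -> quad m' n' x = u%:R ^+ 2 * quad m n (x / u%:R).
  by rewrite /quad => -> ->; rewrite !natrM; field.
have ratioE x : ratio a' b' c' d' x = u%:R * ratio a b c d (x / u%:R).
  rewrite /ratio (quadE _ _ _ _ _ aE bE) (quadE _ _ _ _ _ cE dE).
  (* With the inverse abstracted as [w], [field] only needs [u] to be nonzero. *)
  by rewrite [(_ * quad c d _) ^+ 2]exprMn invfM; set w := quad c d _ ^- 2; field.
move=> x y; rewrite !ratioE => /(mulfI u0) /ratioI.
by apply: mulIf; rewrite invr_eq0.
Qed.

End OddDegreeExtension.

Theorem proposition3p1 (k : nat) (F : finFieldType) (A B C D : 'F_5)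
    (k_gt0 : 0 < k) (k_odd : odd k) (cardF : #|F| = 5 ^ k)
    (hABCD : (A, B, C, D) \in tuples) :
  permutes (g F A B C D) [set: F].
Proof.
have [ratioI irr] : injective (ratio F A B C D) /\ 5 %| (C ^ 2 + D) ^ 2 + 1.
  have scale a b c d ratioI u A' B' C' D' :=
    @ratio_scale k F cardF a b c d u A' B' C' D' ratioI.
  have r1 := scale _ _ _ _ (ratio_inj1 k F k_odd cardF).
  have r2 := scale _ _ _ _ (ratio_inj2 k F k_odd cardF).
  have r3 := scale _ _ _ _ (ratio_inj3 k F k_odd cardF).
  move: hABCD; rewrite !inE.
  case/or4P=> [|||/or4P[|||/or4P[]]] /eqP[-> -> -> ->]; split=> //.
  (* The numbers are the scales [u]. The third orbit has two elements, not four: with [a = c = 0]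
     only [u ^ 2] matters. *)
  - exact: (r1 1).
  - exact: (r2 1).
  - exact: (r2 3).
  - exact: (r1 3).
  - exact: (r1 4).
  - exact: (r2 4).
  - exact: (r2 2).
  - exact: (r1 2).
  - exact: (r3 1).
  - exact: (r3 2).
exists (ratio F A B C D); split.
- move=> x _; exists ('X * quadratic F A B ^+ 2)%R, (quadratic F C D ^+ 2)%R.
  have quadE a b : (quadratic F a b).[x]%R = quad F a b x.
    by rewrite /quadratic !hornerE.
  split; first by rewrite rmorphM !rmorphXn /g mulrA.
    by rewrite horner_exp quadE expf_neq0 // (quad_neq0 k).
  by rewrite hornerM hornerX !horner_exp !quadE.
- by move=> x _; rewrite inE.
- by move=> x y _ _; apply: ratioI.
- by move=> y _; exists (invF ratioI y); rewrite ?inE ?f_invF.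
Qed.
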